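(* Let $X$ be an infinite Tychonoff space and let $*\in\{1,\mathrm{fin}\}$. The following are equivalent: (1) TWO has a winning strategy in $G_*(\Gamma_F,\Omega)$ on $X$; (2) TWO has a winning strategy in $G_*(\Gamma_{\mathbf 0},\Omega_{\mathbf 0})$ on $C_p(X)$; (3) TWO has a winning strategy in $G_*(\mathcal S,\Omega_{\mathbf 0})$ on $C_p(X)$. Moreover, the same three statements with ''winning strategy'' replaced throughout by ''winning Markov strategy'' are also equivalent to each other.
   Context: $C_p(X)$ is the space of all real-valued continuous functions on $X$ with the topology of pointwise convergence; $\mathbf 0$ is the constant zero function. In $C_p(X)$: a set $A$ converges to a point $f$, written $f=\lim A$, if $A$ is infinite, $f\notin A$ and $A\setminus U$ is finite for every neighborhood $U$ of $f$; by convention also $f=\lim\{f\}$. $\Gamma_{\mathbf 0}=\{A\subseteq C_p(X):\mathbf 0=\lim A\}$ and $\Omega_{\mathbf 0}=\{A\subseteq C_p(X):\mathbf 0\in\overline A\setminus A\text{ or }A=\{\mathbf 0\}\}$. $\mathcal S$ is the family of all sequentially dense subsets of $C_p(X)$, where $D$ is sequentially dense if every point of the space is the limit of a sequence from $D$. A cover $\mathcal U$ of $X$ is a family of subsets with $\bigcup\mathcal U=X$ and $X\notin\mathcal U$. It is an $\omega$-cover if every finite subset of $X$ is contained in a member of $\mathcal U$, and a $\gamma$-cover if it is infinite and each $x\in X$ belongs to all but finitely many elements of $\mathcal U$. $\Omega$ is the family of all open $\omega$-covers of $X$. A zero-set of $X$ is the complete preimage of $0$ under some continuous $f:X\to\mathbb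 R$; a cozero-set is the complement of a zero-set. A $\gamma$-cover $\mathcal U$ of $X$ by cozero-sets is $\gamma_F$-shrinkable if there is a $\gamma$-cover $\{F(U):U\in\mathcal U\}$ of $X$ by zero-sets with $F(U)\subseteq U$ for every $U\in\mathcal U$. $\Gamma_F$ is the family of all $\gamma_F$-shrinkable $\gamma$-covers of $X$. Games: in $G_{\mathrm{fin}}(\mathcal A,\mathcal B)$, in round $n\in\omega$ ONE plays $A_n\in\mathcal A$ and TWO responds with a finite $B_n\subseteq A_n$; TWO wins if $\bigcup_n B_n\in\mathcal B$, otherwise ONE wins. $G_1(\mathcal A,\mathcal B)$ is the same except that TWO chooses a single element $b_n\in A_n$ and wins if $\{b_n:n\in\omega\}\in\mathcal B$. A strategy for TWO is a function $\sigma$ assigning to each finite sequence $\langle A_0,\dots,A_n\rangle$ of moves of ONE a legal response to $A_n$; a Markov strategy is a function $\sigma$ assigning to each $A\in\mathcal A$ and $n\in\omega$ a legal response $\sigma(A,n)$ to $A$ in round $n$. A (Markov) strategy is winning if TWO wins every play in which TWO follows it.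
   Formalization: In (2), ONE may play any member of Γ_0 except {0}: with the convention 0 = lim{0} that move is legal and lets ONE defeat every strategy of TWO in G_*(Γ_0, Ω_0), so (2) would always fail, although (1) holds e.g. for X = ℕ discrete. *)

(* Defs.v *)
From HB Require Import structures.
From mathcomp Require Import all_boot all_order all_algebra.
From mathcomp Require Import all_classical all_reals all_analysis.
Import Order.TTheory GRing.Theory Num.Theory.
Import numFieldNormedType.Exports.

Set Implicit Arguments.
Unset Strict Implicit.
Unset Printing Implicit Defensive.

Local Open Scope classical_set_scope.
Local Open Scope ring_scope.

Definition tychonoff_space (X : topologicalType) : Prop :=
  accessible_space X /\ completely_regular_space X.

(* [payoff b] says that TWO wins a play in which TWO's responses are [b]. *)
Record game (T : Type) := Game {
  response : Type;
  moves : set (set T);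
  legal : set T -> response -> Prop;
  payoff : (nat -> response) -> Prop }.

Definition G1 (T : Type) (A B : set (set T)) : game T :=
  {| response := T;
     moves := A;
     legal := fun An b => An b;
     payoff := fun b => B (range b) |}.

Definition Gfin (T : Type) (A B : set (set T)) : game T :=
  {| response := set T;
     moves := A;
     legal := fun An Bn => finite_set Bn /\ Bn `<=` An;
     payoff := fun b => B (\bigcup_n b n) |}.

Variant selection := sel_one | sel_fin.

Definition G (s : selection) (T : Type) (A B : set (set T)) : game T :=
  match s with sel_one => G1 A B | sel_fin => Gfin A B end.

(* A strategy answers every nonempty history [rcons h A], [A] being the last
   move of ONE. *)
Definition two_has_winning_strategy (T : Type) (g : game T) : Prop :=
  exists sigma : seq (set T) -> response g,
    (forall (h : seq (set T)) (A : set T),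
       (forall C, C \in h -> moves g C) -> moves g A ->
       legal A (sigma (rcons h A))) /\
    (forall A : nat -> set T, (forall n, moves g (A n)) ->
       payoff (fun n => sigma (mkseq A n.+1))).

Definition two_has_winning_markov_strategy (T : Type) (g : game T) : Prop :=
  exists sigma : set T -> nat -> response g,
    (forall (A : set T) (n : nat), moves g A -> legal A (sigma A n)) /\
    (forall A : nat -> set T, (forall n, moves g (A n)) ->
       payoff (fun n => sigma (A n) n)).

Definition is_cover (X : Type) (U : set (set X)) : Prop :=
  \bigcup_(V in U) V = setT /\ ~ U setT.

Definition omega_cover (X : Type) (U : set (set X)) : Prop :=
  is_cover U /\
  forall F : set X, finite_set F -> exists2 V, U V & F `<=` V.

Definition gamma_cover (X : Type) (U : set (set X)) : Prop :=
  [/\ is_cover U, infinite_set U &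
      forall x : X, finite_set [set V | U V /\ ~ V x]].

Definition open_omega_covers (X : topologicalType) : set (set (set X)) :=
  [set U | omega_cover U /\ forall V, U V -> open V].
Arguments open_omega_covers X : clear implicits.

Definition zero_set (R : realType) (X : topologicalType) (Z : set X) : Prop :=
  exists2 f : X -> R, continuous f & Z = f @^-1` [set 0].

Definition cozero_set (R : realType) (X : topologicalType) (V : set X) : Prop :=
  zero_set R (~` V).

Definition gammaF_shrinkable (R : realType) (X : topologicalType)
    (U : set (set X)) : Prop :=
  exists F : set X -> set X,
    [/\ forall V, U V -> zero_set R (F V),
        forall V, U V -> F V `<=` V &
        gamma_cover (F @` U)].

Definition GammaF (R : realType) (X : topologicalType) : set (set (set X)) :=
  [set U | [/\ gamma_cover U,
               forall V, U V -> cozero_set R V &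
               gammaF_shrinkable R U]].
Arguments GammaF R X : clear implicits.

Definition Cp (R : realType) (X : topologicalType) : Type :=
  continuousType X R.

HB.instance Definition _ (R : realType) (X : topologicalType) :=
  Topological.copy (Cp R X)
    (initial_topology (fun f : continuousType X R => (f : {ptws X -> R}))).

Definition Cp0 (R : realType) (X : topologicalType) : Cp R X :=
  mkcts (fun x : X => @cst_continuous X R (0 : R) x).

(* The singleton case is the convention f = lim {f}. *)
Definition set_lim (T : topologicalType) (A : set T) (f : T) : Prop :=
  A = [set f] \/
  [/\ infinite_set A, ~ A f & forall V, nbhs f V -> finite_set (A `\` V)].

Definition Gamma_at (T : topologicalType) (f : T) : set (set T) :=
  [set A | set_lim A f].

Definition Omega_at (T : topologicalType) (f : T) : set (set T) :=
  [set A | (closure A `\` A) f \/ A = [set f]].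

Definition sequentially_dense (T : topologicalType) : set (set T) :=
  [set D | forall f : T,
     exists2 u : nat -> T, (forall n, D (u n)) & u @ \oo --> f].
Arguments sequentially_dense T : clear implicits.

(* The members of [Gamma_at f] that ONE may play. The convention f = lim {f}
   must not give ONE the move {f}: were it legal, ONE would beat every strategy
   of TWO against [Omega_at f] as soon as f is the limit of some other set in
   [Gamma_at f]. Indeed a set in [Omega_at f] containing f equals {f}, and no
   finite set avoiding f belongs to [Omega_at f] when points are closed; so ONE
   can mix {f} with a nontrivial A converging to f. *)
Definition Gamma_at_moves (T : topologicalType) (f : T) : set (set T) :=
  Gamma_at f `\ [set f].

(* Main.v *)
Require Import Defs.
From mathcomp Require Import all_boot all_order all_algebra.
From mathcomp Require Import all_classical all_reals all_analysis.
From mathcomp Require Import lra.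
Import Order.TTheory GRing.Theory Num.Theory numFieldNormedType.Exports.

(** Both function-space games are compared with the cover game, by translating
    each move of ONE in one game into a move in the other and translating TWO's
    answer back. The translation of a move depends only on that move and on the
    number of the round, so it carries winning strategies and winning Markov
    strategies alike ([strategies_carry_G]).

    From functions to covers ([strategies_carry_to_covers]): a cover [U] is
    replaced by a set of functions each of which equals 1 off some member of
    [U], and TWO's answer [f] is turned into such a member [V]. If |f| < 1 on a
    finite set, that set lies in [V], so answers accumulating at zero yield an
    omega-cover. Shrinkability of [U] provides a sequence of such functions that
    are eventually 0 at each point ([shrinkable_urysohn]). The sequence itself
    converges to zero, and it glues every function to the constant 1, so the
    functions that equal 1 off a member of [U] are sequentially dense.

    From covers to functions ([strategies_carry_from_covers]): in round [n], a
    set [D] of functions contains nonzero functions [u k] converging pointwise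
    to a constant [c] with |c| <= 1/(n+1). If none of the sets
    [{x | |u k x - c| < 1/(n+1)}] is the whole space, they form a
    gammaF-shrinkable cover, and TWO answers with a function smaller than
    2/(n+1) on the set chosen in the cover game. Otherwise TWO answers with a
    nonzero function smaller than 2/(n+1) everywhere. Infinitely many rounds of
    the second kind already accumulate at zero; if there are only finitely many,
    they can be discarded, because an omega-cover stays an omega-cover when
    finitely many members are removed.

    For sets converging to zero one takes c = 0. A sequentially dense set may
    contain zero, which TWO must avoid, and its nonzero members need not contain
    a sequence converging to zero; there one takes c = 1/(n+1). *)

Set Implicit Arguments.
Unset Strict Implicit.
Unset Printing Implicit Defensive.

Local Open Scope classical_set_scope.
Local Open Scope ring_scope.

(** * Carrying strategies from one game to another *)

Definition strategies_carry (T T' : Type) (g : game T) (g' : game T') : Prop :=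
  (two_has_winning_strategy g -> two_has_winning_strategy g') /\
  (two_has_winning_markov_strategy g -> two_has_winning_markov_strategy g').

(** In the course of a play TWO keeps translating the whole history, so that the
    answers returned belong to one play of the first game. *)
Lemma strategies_carry_by (T T' : Type) (g : game T) (g' : game T')
    (phi : nat -> set T' -> set T)
    (psi : nat -> set T' -> response g -> response g') :
  (forall n D, moves g' D -> moves g (phi n D)) ->
  (forall n D b, moves g' D -> legal (phi n D) b -> legal D (psi n D b)) ->
  (forall D b, (forall n, moves g' (D n)) ->
     (forall n, legal (phi n (D n)) (b n)) -> payoff b ->
     payoff (fun n => psi n (D n) (b n))) ->
  strategies_carry g g'.
Proof.
move=> phi_moves psi_legal psi_payoff; split=> -[sigma [sigma_legal sigma_win]].
  pose img (h : seq (set T')) := mkseq (fun i => phi i (nth set0 h i)) (size h).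
  have img_rcons h D : img (rcons h D) = rcons (img h) (phi (size h) D).
    rewrite /img size_rcons mkseqS nth_rcons ltnn eqxx; congr rcons.
    by apply/eq_in_map => i; rewrite mem_iota /= nth_rcons add0n => ->.
  have img_moves h C : (forall D, D \in h -> moves g' D) ->
      C \in img h -> moves g C.
    move=> hP /mapP[i]; rewrite mem_iota add0n /= => ih ->.
    by apply: phi_moves; apply: hP; exact: mem_nth.
  exists (fun h => psi (size h).-1 (last set0 h) (sigma (img h))); split.
    move=> h D hP DP; rewrite size_rcons last_rcons img_rcons /=.
    apply: psi_legal => //; apply: sigma_legal; last exact: phi_moves.
    by move=> C; exact: img_moves.
  move=> D DP.
  have imgE n : img (mkseq D n) = mkseq (fun i => phi i (D i)) n.
    rewrite /img size_mkseq; apply/eq_in_map => i.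
    by rewrite mem_iota add0n => /andP[_ ilt]; rewrite nth_mkseq.
  rewrite (_ : (fun n => _) =
      fun n => psi n (D n) (sigma (mkseq (fun i => phi i (D i)) n.+1))).
    apply: psi_payoff => //; last by apply: sigma_win => n; exact: phi_moves.
    move=> n; rewrite mkseqS; apply: sigma_legal; last exact: phi_moves.
    by move=> C /mapP[i _ ->]; exact: phi_moves.
  apply/funext => n.
  by rewrite size_mkseq imgE (mkseqS D) last_rcons.
exists (fun D n => psi n D (sigma (phi n D) n)); split.
  by move=> D n DP; apply: psi_legal => //; apply: sigma_legal; exact: phi_moves.
move=> D DP.
apply: (psi_payoff D (fun n => sigma (phi n (D n)) n)) => //.
  by move=> n; apply: sigma_legal; exact: phi_moves.
by apply: (sigma_win (fun n => phi n (D n))) => n; exact: phi_moves.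
Qed.

(** TWO's way of handling one move [D] of ONE in a second game: pretend that ONE
    played [translation] in a first game, turn an element [t] chosen there into
    [answer t], and never leave the part [zone] of [D]. The zone also bounds
    answers that come from no element of [translation]. *)
Record reduction (T T' : Type) := Reduction {
  translation : set T;
  answer : T -> T';
  zone : set T' }.

(** One argument covers single selections and finite selections: in the payoff
    condition, [b n] is the set selected in the first game and [b' n] the one
    selected in the second. In the finite game TWO may select nothing, which
    would waste rounds whose whole zone is winning for TWO; so TWO adds a point
    of the zone in every round, and [b' n] is only required to contain the
    answers to [b n]. *)
Lemma strategies_carry_G (s : selection) (T T' : Type) (t0 : T')
    (A B : set (set T)) (A' B' : set (set T'))
    (good : nat -> set T' -> reduction T T' -> Prop) :
  (forall n D, A' D -> exists r, good n D r) ->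
  (forall n D r, A' D -> good n D r ->
     [/\ A (translation r), zone r `<=` D, zone r !=set0 &
         forall x, translation r x -> zone r (answer r x)]) ->
  (forall D r b b', (forall n, A' (D n)) -> (forall n, good n (D n) (r n)) ->
     (forall n, finite_set (b n) /\ b n `<=` translation (r n)) ->
     B (\bigcup_n b n) ->
     (forall n, b' n `<=` zone (r n) /\ b' n !=set0) ->
     (forall n, answer (r n) @` b n `<=` b' n) ->
     B' (\bigcup_n b' n)) ->
  strategies_carry (G s A B) (G s A' B').
Proof.
move=> ex_good goodP payoffP.
have /choice[red redP] : forall nD : nat * set T', exists r,
    A' nD.2 -> good nD.1 nD.2 r.
  move=> [n D] /=.
  have [/(ex_good n)[r rP]|] := pselect (A' D); first by exists r.
  by exists (Reduction set0 (fun=> t0) set0).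
have {}redP n D : A' D -> good n D (red (n, D)) by move=> /(redP (n, D)).
have red_good n D (AD : A' D) := goodP n D _ AD (redP n D AD).
case: s.
- apply: (@strategies_carry_by _ _ (G1 A B) (G1 A' B')
    (fun n D => translation (red (n, D))) (fun n D => answer (red (n, D)))).
  + by move=> n D /= /(red_good n)[].
  + by move=> n D b /= /(red_good n)[_ zD _ zP] /zP /zD.
  move=> D b /= DA bP bB.
  have rangeE (U : Type) (u : nat -> U) : range u = \bigcup_n [set u n].
    by rewrite -bigcup_imset1; apply: eq_bigcupl.
  rewrite rangeE; apply: (payoffP D (fun n => red (n, D n)) (fun n => [set b n])).
  + by [].
  + by move=> n; exact: redP.
  + by move=> n; split=> // _ ->; exact: bP.
  + by rewrite -rangeE.
  + move=> n; split; last by exists (answer (red (n, D n)) (b n)).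
    by have [_ _ _ zP] := red_good n _ (DA n) => _ ->; apply: zP; exact: bP.
  + by move=> n _ [_ -> <-].
have /choice[extra' extraP'] : forall nD : nat * set T', exists z,
    A' nD.2 -> zone (red nD) z.
  move=> [n D] /=; have [AD|] := pselect (A' D); last by exists t0.
  by have [_ _ [z zz] _] := red_good n _ AD; exists z.
pose extra n D := extra' (n, D).
have extraP n D : A' D -> zone (red (n, D)) (extra n D).
  by move=> AD; exact: (extraP' (n, D)).
apply: (@strategies_carry_by _ _ (Gfin A B) (Gfin A' B')
  (fun n D => translation (red (n, D)))
  (fun n D b => answer (red (n, D)) @` b `|` [set extra n D])).
- by move=> n D /= /(red_good n)[].
- move=> n D b /= AD [bfin bsub]; split.
    by rewrite finite_setU; split=> //; exact: finite_image.
  have [_ zD _ zP] := red_good n _ AD.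
  by move=> _ [[x /bsub bx <-]|->]; apply: zD; [exact: zP | exact: extraP].
move=> D b /= DA bP bB.
apply: (payoffP D (fun n => red (n, D n)) b) => //.
- by move=> n; exact: redP.
- move=> n; split; last by exists (extra n (D n)); right.
  have [_ _ _ zP] := red_good n _ (DA n).
  move=> _ [[x bx <-]|->]; last exact: extraP.
  by apply: zP; apply: (bP n).2.
Qed.

(** * Infinite families that are eventually everywhere *)

Lemma infinite_image (I J : Type) (A : set I) (f : I -> J) :
  infinite_set A -> (forall i, A i -> finite_set [set k | A k /\ f k = f i]) ->
  infinite_set (f @` A).
Proof.
move=> Ainf fib fAfin; apply: Ainf.
have -> : A = \bigcup_(j in f @` A) [set k | A k /\ f k = j].
  apply/seteqP; split=> [i Ai|i [_ _ [//]]].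
  by exists (f i) => //; exists i.
by apply: bigcup_finite => // _ [i Ai <-]; exact: fib.
Qed.

Lemma infinite_set_seq (T : Type) (A : set T) : infinite_set A ->
  exists2 u : nat -> T, injective u & forall n, A (u n).
Proof.
move=> /infiniteP/card_leP[f].
pose pt n : [set: nat] := SigSub (mem_set (I : [set: nat] n)).
exists (fun n => val (f (pt n))); last first.
  by move=> n; have := valP (f (pt n)); rewrite inE.
move=> m n /val_inj fmn; suff /(congr1 val) : pt m = pt n by [].
by apply: (@inj _ _ _ f) => //; rewrite inE.
Qed.

Lemma near_infty_notin_finite (A : set nat) :
  finite_set A -> \forall n \near \oo, ~ A n.
Proof.
move=> /finite_fsetP[F ->].
exists (\max_(i <- finmap.enum_fset F) i).+1 => // n /= Fn nF.
by move: Fn; rewrite ltnNge (leq_bigmax_seq (F := id)).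
Qed.

Lemma near_infty_inj_notin (T : Type) (u : nat -> T) (A : set T) :
  injective u -> finite_set A -> \forall n \near \oo, ~ A (u n).
Proof.
move=> u_inj Afin; apply: near_infty_notin_finite.
by apply: finite_preimage => // m n _ _; exact: u_inj.
Qed.

Lemma finite_near_infty (P : nat -> Prop) :
  (\forall n \near \oo, P n) -> finite_set [set n | ~ P n].
Proof.
move=> [N _ NP]; apply: sub_finite_set (finite_II N) => n /=.
by apply: contra_notT; rewrite -leqNgt => /NP.
Qed.

(** The image is infinite because [F i] misses some point, which only finitely
    many indices do: the value [F i] is taken finitely often. *)
Lemma gamma_cover_image (I X : Type) (A : set I) (F : I -> set X) :
  infinite_set A -> (forall i, A i -> F i <> setT) ->
  (forall x, finite_set [set i | A i /\ ~ F i x]) -> gamma_cover (F @` A).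
Proof.
move=> Ainf Fprop Ffin; split.
- split; last by move=> [i Ai]; exact: Fprop.
  apply/seteqP; split=> // x _.
  have /infinite_setN0[i [Ai nFix]] := infinite_setD Ainf (Ffin x).
  by exists (F i); [exists i | apply: contrapT => Fix; apply: nFix].
- apply: infinite_image => // i /Fprop/eqP/setTPn[x nFix].
  by apply: sub_finite_set (Ffin x) => k /= [Ak ->].
- move=> x; apply: sub_finite_set (finite_image F (Ffin x)).
  by move=> _ [[i Ai <-] nFix]; exists i.
Qed.

(** * Pointwise convergence *)

Lemma filter_finite_bigI (T : Type) (I : choiceType) (K : set I)
    (f : I -> set T) (F : set_system T) : Filter F -> finite_set K ->
  (forall i, K i -> F (f i)) -> F (\bigcap_(i in K) f i).
Proof.
by move=> FF /finite_fsetP[D ->] Ff; apply: filter_bigI => i; exact: Ff.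
Qed.

Section PointwiseConvergence.
Context (R : realType) (X : topologicalType).

Lemma Cp_cvgP (F : set_system (Cp R X)) (f : Cp R X) : Filter F ->
  F --> f <-> forall x : X, (fun g : Cp R X => g x) @ F --> f x.
Proof.
move=> FF; split=> [Ff x|Ff].
  have Ff' : (fun g : Cp R X => (g : {ptws X -> R})) @ F --> (f : {ptws X -> R}).
    apply: cvg_trans (@initial_continuous _ _
      (fun g : continuousType X R => (g : {ptws X -> R})) f).
    exact: cvg_app.
  by have /pointwise_cvgP := Ff'; apply.
have Ff' : {ptws, (fun g : Cp R X => (g : X -> R)) @ F --> (f : X -> R)}.
  by apply/pointwise_cvgP => x; exact: Ff.
move=> A [B [[C oC <-] Cf] CA].
by apply: filterS CA _; apply: Ff'; exact: open_nbhs_nbhs.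
Qed.

Definition fin_ball (f : Cp R X) (K : set X) (e : R) : set (Cp R X) :=
  [set g | forall x, K x -> `|f x - g x| < e].

Lemma nbhs_fin_ball (f : Cp R X) (K : set X) (e : R) :
  finite_set K -> 0 < e -> nbhs f (fin_ball f K e).
Proof.
move=> Kfin e0; rewrite [fin_ball _ _ _](_ : _ =
    \bigcap_(x in K) [set g : Cp R X | `|f x - g x| < e]).
  apply: filter_finite_bigI => // x _.
  have /Cp_cvgP/(_ x)/cvgr_dist_lt/(_ _ e0) : nbhs f --> f by [].
  by [].
by [].
Qed.

(** The sets containing a ball [fin_ball f K e] form a filter that converges to
    [f] at each point, hence in [Cp]; so it is finer than the neighborhoods. *)
Lemma nbhs_fin_ballP (f : Cp R X) (A : set (Cp R X)) : nbhs f A ->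
  exists K e, [/\ finite_set K, 0 < e & fin_ball f K e `<=` A].
Proof.
pose F := filter_from [set Ke : set X * R | finite_set Ke.1 /\ 0 < Ke.2]
  (fun Ke => fin_ball f Ke.1 Ke.2).
have FF : Filter F.
  apply: filter_from_filter; first by exists (set0, 1).
  move=> [K d] [L e] /= [Kfin d0] [Lfin e0].
  exists (K `|` L, Num.min d e) => /=.
    by rewrite lt_min d0 e0 finite_setU.
  move=> g gKL; split=> x xK; have := gKL x; rewrite lt_min.
    by move=> /(_ (or_introl xK))/andP[].
  by move=> /(_ (or_intror xK))/andP[].
have : F --> f.
  apply/Cp_cvgP => x; apply/cvgrPdist_lt => e e0.
  exists ([set x], e) => //= g; exact.
by move=> /[apply] -[[K e] /= [Kfin e0] KA]; exists K, e.
Qed.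

Lemma closure_CpP (f : Cp R X) (S : set (Cp R X)) :
  closure S f <-> forall K e, finite_set K -> 0 < e ->
    exists2 g, S g & fin_ball f K e g.
Proof.
split=> [Sf K e Kfin e0|SP A /nbhs_fin_ballP[K [e [Kfin e0 KA]]]].
  by have [g [Sg gK]] := Sf _ (nbhs_fin_ball f Kfin e0); exists g.
by have [g Sg gK] := SP K e Kfin e0; exists g; split=> //; exact: KA.
Qed.

Lemma Cp_cvg_seqP (u : nat -> Cp R X) (f : Cp R X) :
  u @ \oo --> f <-> forall x, u n x @[n --> \oo] --> f x.
Proof. exact: Cp_cvgP. Qed.

End PointwiseConvergence.

(** * From functions to covers *)

Section Games.
Context (R : realType) (X : topologicalType).
Implicit Types (U : set (set X)) (D : set (Cp R X)) (s : selection).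

Lemma zero_set_closed (Z : set X) : zero_set R Z -> closed Z.
Proof.
by move=> [f /continuous_closedP fc ->]; apply: fc; exact: closed_eq.
Qed.

Lemma cozero_set_open (V : set X) : cozero_set R V -> open V.
Proof. by move=> /zero_set_closed; rewrite -openC setCK. Qed.

Lemma zero_set_le0 (h : X -> R) : continuous h -> zero_set R [set x | h x <= 0].
Proof.
move=> hc; exists (fun x => h x + `|h x|).
  move=> x; apply: cvgD; first exact: hc.
  by apply: cvg_norm; exact: hc.
apply/seteqP; split=> x /= hx; first by rewrite ler0_norm// subrr.
by have := normr_ge0 (h x); lra.
Qed.

Lemma zero_sets_separation (V Z : set X) :
  cozero_set R V -> zero_set R Z -> Z `<=` V ->
  exists f : Cp R X, (forall x, Z x -> f x = 0) /\ (forall x, ~ V x -> f x = 1).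
Proof.
move=> [g gc gV] [h hc hZ] ZV.
have gVE x : (g x == 0) = ~~ `[< V x >].
  by apply/eqP/asboolPn => [gx|nVx]; [rewrite -[~ _]/((~` V) x) gV
    | move: nVx; rewrite -[~ _]/((~` V) x) gV].
have hZE x : (h x = 0) <-> Z x by rewrite hZ.
have gh0 x : `|h x| + `|g x| != 0.
  rewrite gt_eqF// lt_neqAle addr_ge0// andbT eq_sym paddr_eq0// !normr_eq0.
  apply/negP => /andP[/eqP/hZE/ZV Vx].
  by rewrite gVE => /asboolPn.
have fc : continuous (fun x => `|h x| / (`|h x| + `|g x|)).
  move=> x; apply: cvgM; first by apply: cvg_norm; exact: hc.
  apply: cvgV => //; apply: cvgD; apply: cvg_norm; [exact: hc|exact: gc].
exists (mkcts fc); split=> x /=.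
  by move=> /hZE; rewrite /mkcts => ->; rewrite normr0 mul0r.
move=> /asboolPn; rewrite -gVE => /eqP g0; have := gh0 x.
by rewrite /mkcts g0 normr0 addr0 => /divff.
Qed.

(** The way functions code members of a cover: a set on which such an [f] is
    smaller than 1 is contained in the member [V]. *)
Definition confined U : set (Cp R X) :=
  [set f | exists2 V, U V & forall x, ~ V x -> f x = 1].

Lemma confined_neq0 U : gamma_cover U -> ~ confined U (Cp0 R X).
Proof.
move=> [[_ UT] _ _] [V UV V1]; apply: UT.
suff <- : V = setT by [].
apply/seteqP; split=> // x _; apply: contrapT => /V1 /eqP.
by rewrite eq_sym oner_eq0.
Qed.

Lemma strategies_carry_to_covers s (M : set (set (Cp R X))) :
  (forall U, GammaF R X U -> exists2 A, M A & A `<=` confined U) ->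
  strategies_carry (G s M (Omega_at (Cp0 R X)))
                   (G s (GammaF R X) (open_omega_covers X)).
Proof.
move=> exM.
pose good (n : nat) U (r : reduction (Cp R X) (set X)) :=
  [/\ M (translation r), zone r = U &
      forall f, translation r f ->
        U (answer r f) /\ forall x, ~ answer r f x -> f x = 1].
apply: (@strategies_carry_G s _ _ set0 _ _ _ _ good).
- move=> n U UG; have [A MA AU] := exM U UG.
  have /choice[v vP] : forall f, exists V, A f ->
      U V /\ forall x, ~ V x -> f x = 1.
    move=> f; have [/AU[V UV V1]|] := pselect (A f); first by exists V.
    by exists set0.
  by exists (Reduction A v U).
- move=> n U r [[_ /infinite_setN0 UN0 _] _ _] [MA -> rP]; split=> //.
  by move=> f /rP[].
- move=> U r b b' UG rP bP bO b'P gb.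
  have b'U n : b' n `<=` U n by have [_ <- _] := rP n; have [] := b'P n.
  have b'cov (K : set X) : finite_set K ->
      exists2 V, (\bigcup_n b' n) V & K `<=` V.
    move=> Kfin.
    (* TWO cannot have played only the zero function: [confined_neq0]. *)
    case: bO => [[/closure_CpP/(_ K 1 Kfin ltr01)[f [n _ bnf] fK] _]|bE].
      have [_ _ /(_ f ((bP n).2 _ bnf))[UV V1]] := rP n.
      exists (answer (r n) f); first by exists n => //; apply: gb; exists f.
      move=> x /fK; rewrite /= sub0r normrN => fx1; apply: contrapT => /V1 fx.
      by move: fx1; rewrite fx normr1 ltxx.
    have [n _ bn0] : (\bigcup_n b n) (Cp0 R X) by rewrite bE.
    have [Ugam _ _] := UG n.
    have [_ _ /(_ _ ((bP n).2 _ bn0))[UV V1]] := rP n.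
    by case: (confined_neq0 Ugam); exists (answer (r n) (Cp0 R X)).
  split; last first.
    by move=> V [n _ /b'U UV]; have [_ + _] := UG n => /(_ V UV)/cozero_set_open.
  split=> //; split.
    apply/seteqP; split=> // x _; have [V bV xV] := b'cov _ (finite_set1 x).
    by exists V => //; exact: xV.
  by move=> [n _ /b'U]; have [[[_ +]]] := UG n.
Qed.

(** Each function is 0 on a zero-set [F (V n)] of the shrinking and 1 off [V n].
    Convergence at a point requires the sets [F (V n)] to be pairwise distinct,
    and [F] need not be injective: so the sequence is extracted from [F @` U],
    not from [U]. *)
Lemma shrinkable_urysohn U : GammaF R X U ->
  exists (V : nat -> set X) (phi : nat -> Cp R X),
    [/\ forall n, U (V n), forall n x, ~ V n x -> phi n x = 1 &
        forall x, \forall n \near \oo, phi n x = 0].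
Proof.
move=> [Ugam Ucoz [F [Fzero FV [_ /infinite_set_seq[Z Zinj FZ] Ffin]]]].
have /choice[V VP] : forall n, exists V, U V /\ F V = Z n.
  by move=> n; have [V UV FVZ] := FZ n; exists V.
have /choice[phi phiP] : forall n, exists f : Cp R X,
    (forall x, Z n x -> f x = 0) /\ (forall x, ~ V n x -> f x = 1).
  move=> n; have [UV FVZ] := VP n; rewrite -FVZ.
  by apply: zero_sets_separation; [exact: Ucoz | exact: Fzero | exact: FV].
exists V, phi; split=> [n|n|x]; [exact: (VP n).1 | exact: (phiP n).2 |].
have := near_infty_inj_notin Zinj (Ffin x); apply: filterS => n nZ.
by apply: (phiP n).1; apply: contrapT => ?; apply: nZ; split.
Qed.

Lemma confined_Gamma_at U : GammaF R X U ->
  exists2 A, Gamma_at_moves (Cp0 R X) A & A `<=` confined U.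
Proof.
move=> UG; have [V [phi [UV phi1 phi0]]] := shrinkable_urysohn UG.
have [Ugam _ _] := UG.
have sub : range phi `<=` confined U.
  by move=> _ [n _ <-]; exists (V n) => // x /phi1.
have n0 : ~ range phi (Cp0 R X) by move=> /sub; exact: confined_neq0.
exists (range phi) => //; split; last by move=> E; apply: n0; rewrite E.
right; split=> //.
  apply: infinite_image; first exact: infinite_nat.
  move=> n _.
  have [x nVx] : exists x, ~ V n x.
    apply/setTPn/eqP => VT; case: Ugam => -[_ + _ _]; apply.
    by rewrite -VT.
  apply: sub_finite_set (finite_near_infty (phi0 x)) => k /= [_ ->].
  by rewrite phi1// => /eqP; rewrite oner_eq0.
have phi_cvg : phi @ \oo --> Cp0 R X.
  by apply/Cp_cvg_seqP => x; apply: cvg_near_cst; exact: phi0.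
move=> W /phi_cvg /finite_near_infty/(finite_image phi).
by apply: sub_finite_set => _ [[n _ <-] nW]; exists n.
Qed.

(** Gluing [f] on the zero-sets of the shrinking to 1 off the members of [U]
    gives confined functions that eventually agree with [f] at each point. *)
Lemma confined_sequentially_dense U : GammaF R X U ->
  sequentially_dense (Cp R X) (confined U).
Proof.
move=> UG f; have [V [phi [UV phi1 phi0]]] := shrinkable_urysohn UG.
have uc n : continuous (fun x => f x + phi n x * (1 - f x)).
  move=> x; apply: cvgD; first exact: cts_fun.
  apply: cvgM; first exact: cts_fun.
  by apply: cvgB; [exact: cvg_cst | exact: cts_fun].
exists (fun n => mkcts (uc n) : Cp R X).
  move=> n; exists (V n) => // x /phi1 /= p1.
  by rewrite /mkcts p1 mul1r addrC subrK.
apply/Cp_cvg_seqP => x; apply: cvg_near_cst.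
by apply: filterS (phi0 x) => n /= p0; rewrite /mkcts p0 mul0r addr0.
Qed.

(** * From covers to functions *)

(** The shrinking consists of the sets where the distance is at most [e / 2].
    Distinct indices may give the same member of the cover, so an index [m W] is
    selected for each member [W]. *)
Lemma GammaF_of_cvg (u : nat -> Cp R X) (c e : R) : 0 < e ->
  (forall x, u n x @[n --> \oo] --> c) ->
  (forall n, [set x | `|u n x - c| < e] <> setT) ->
  GammaF R X (range (fun n => [set x | `|u n x - c| < e])).
Proof.
move=> e0 uc; set V := fun n : nat => _ => VT.
have far d x : 0 < d -> finite_set [set n | ~ `|u n x - c| < d].
  move=> d0; apply: finite_near_infty.
  have /cvgrPdist_lt/(_ d d0) := uc x.
  by apply: filterS => n /=; rewrite distrC.
have contu n (a : R) : continuous (fun x => `|u n x - c| + a).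
  move=> x; apply: cvgD; last exact: cvg_cst.
  by apply: cvg_norm; apply: cvgB; [exact: cts_fun | exact: cvg_cst].
have Vgam : gamma_cover (range V).
  apply: gamma_cover_image; first exact: infinite_nat.
    by move=> n _; exact: VT.
  by move=> x; apply: sub_finite_set (far e x e0) => n [].
have /choice[m mP] : forall W, exists n, range V W -> V n = W.
  by move=> W; have [[n _ <-]|] := pselect (range V W); [exists n | exists 0%N].
pose F W := [set x | `|u (m W) x - c| - e / 2 <= 0].
have FV W : range V W -> F W `<=` W.
  by move=> /mP {2}<- x; rewrite /F /V /= => h; lra.
split=> //.
  move=> _ [n _ <-]; rewrite /cozero_set.
  have -> : ~` V n = [set x | - (`|u n x - c| + - e) <= 0].
    apply/seteqP; split=> x; rewrite /V /=.
      by move=> /negP; rewrite -leNgt => h; lra.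
    by move=> h; apply/negP; rewrite -leNgt; lra.
  by apply: zero_set_le0 => x; apply: cvgN; exact: contu.
exists F; split=> //; first by move=> W _; apply: zero_set_le0; exact: contu.
apply: gamma_cover_image; first by case: Vgam.
  move=> W VW FT; have [n _ nW] := VW; apply: (VT n).
  by rewrite -/(V n) nW; apply/seteqP; split=> // x _; apply: (FV W VW); rewrite FT.
move=> x; have e20 : 0 < e / 2 by lra.
apply: sub_finite_set (finite_image V (far _ x e20)) => W /= [VW nFWx].
exists (m W); last exact: mP.
by rewrite /=; apply: contra_not nFWx; rewrite /F /=; lra.
Qed.

Lemma Omega_at_Cp0 (S : set (Cp R X)) : ~ S (Cp0 R X) ->
  (forall (K : set X) e, finite_set K -> 0 < e ->
     exists2 f, S f & forall x, K x -> `|f x| < e) ->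
  Omega_at (Cp0 R X) S.
Proof.
move=> S0 SP; left; split=> //; apply/closure_CpP => K e Kfin e0.
have [f Sf fK] := SP K e Kfin e0; exists f => // x /fK.
by rewrite /= sub0r normrN.
Qed.

Lemma natSinv_lt (e : R) : 0 < e ->
  exists N, forall n, (N <= n)%N -> 2 * n.+1%:R^-1 < e.
Proof.
move=> e0; have e20 : 0 < e / 2 by lra.
have [N _ NP] := near_infty_natSinv_lt (PosNum e20).
exists N => n Nn; have h : n.+1%:R^-1 < e / 2 by exact: NP.
by rewrite mulrC -ltr_pdivlMr.
Qed.

(** A source of strategies for the case in which ONE has no move at all in the
    cover game: a strategy for that game carries no information then. *)
Lemma trivial_game_wins s :
  two_has_winning_strategy (G s [set [set: unit]] setT) /\
  two_has_winning_markov_strategy (G s [set [set: unit]] setT).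
Proof.
case: s; split.
- by exists (fun=> tt); split=> // h A _ ->.
- by exists (fun=> fun=> tt); split=> // A n ->.
- by exists (fun=> set0); split=> // h A _ _; split=> //; exact: finite_set0.
- by exists (fun=> fun=> set0); split=> // A n _; split=> //; exact: finite_set0.
Qed.

(** The constant [c] may depend on the round, so that both sets converging to
    zero and sequentially dense sets qualify. *)
Definition approximating (M : set (set (Cp R X))) : Prop :=
  forall (n : nat) D, M D -> exists c (u : nat -> Cp R X),
    [/\ `|c| <= n.+1%:R^-1, forall k, D (u k), forall k, u k <> Cp0 R X &
        forall x, u k x @[k --> \oo] --> c].

Lemma approximating_dichotomy M n D : approximating M -> M D ->
  (exists f, [/\ D f, f <> Cp0 R X & forall x, `|f x| < 2 * n.+1%:R^-1]) \/
  exists U (g : set X -> Cp R X), GammaF R X U /\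
    forall V, U V -> [/\ D (g V), g V <> Cp0 R X &
                      forall x, V x -> `|g V x| < 2 * n.+1%:R^-1].
Proof.
move=> Mapp /(Mapp n)[c [u [cle Du u0 uc]]].
set e := n.+1%:R^-1 in cle *.
have e0 : 0 < e by rewrite invr_gt0.
pose V k := [set x | `|u k x - c| < e].
have Vlt k x : V k x -> `|u k x| < 2 * e.
  rewrite /V /= => h; have := ler_normD (u k x - c) c; rewrite subrK; lra.
have [[k VT]|/forallNP VT] := pselect (exists k, V k = setT).
  by left; exists (u k); split=> // x; apply: Vlt; rewrite VT.
right; have /choice[k kP] : forall W, exists k, range V W -> V k = W.
  by move=> W; have [[k _ <-]|] := pselect (range V W); [exists k | exists 0%N].
exists (range V), (fun W => u (k W)); split; first exact: GammaF_of_cvg.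
by move=> W /kP VW; split=> // x; rewrite -{1}VW; exact: Vlt.
Qed.

(** In a round answered by a function that is small everywhere, ONE is made to
    play an arbitrary cover [U0] in the cover game, and the zone is the singleton
    of that function. *)
Lemma strategies_carry_from_covers s (M : set (set (Cp R X))) :
  approximating M ->
  strategies_carry (G s (GammaF R X) (open_omega_covers X))
                   (G s M (Omega_at (Cp0 R X))).
Proof.
move=> Mapp.
have [[U0 U0G]|noU] := pselect (exists U, GammaF R X U); last first.
  pose good n D (r : reduction unit (Cp R X)) := translation r = setT /\
    exists f, [/\ zone r = [set f], D f, f <> Cp0 R X,
      forall t, answer r t = f & forall x, `|f x| < 2 * n.+1%:R^-1].
  have [] : strategies_carry (G s [set [set: unit]] setT)
      (G s M (Omega_at (Cp0 R X))).
    apply: (@strategies_carry_G s _ _ (Cp0 R X) _ _ _ _ good).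
    - move=> n D MD.
      have [[f [Df f0 fn]]|[U [g [UG _]]]] := approximating_dichotomy n Mapp MD.
        by exists (Reduction setT (fun=> f) [set f]); split=> //; exists f.
      by case: noU; exists U.
    - move=> n D r MD [rT [f [rf Df f0 rA _]]]; split=> //.
      + by rewrite rf => _ ->.
      + by rewrite rf; exists f.
      + by move=> t _; rewrite rf rA.
    - move=> D r b b' MD rP _ _ b'P _; apply: Omega_at_Cp0.
        move=> [n _ b0]; have [_ [f [rf _ f0 _ _]]] := rP n; apply: f0.
        by have := (b'P n).1 _ b0; rewrite rf.
      move=> K e Kfin /natSinv_lt[N NP].
      have [b'N [f bf]] := b'P N; exists f; first by exists N.
      move=> x _; apply: lt_trans (NP N (leqnn N)).
      have [_ [h [rh _ _ _ hN]]] := rP N.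
      by have := b'N _ bf; rewrite rh => ->.
  have [w wm] := trivial_game_wins s.
  by move=> c cm; split=> _; [exact: c|exact: cm].
pose good n D (r : reduction (set X) (Cp R X)) :=
  [/\ GammaF R X (translation r), zone r `<=` D `\ Cp0 R X, zone r !=set0,
      forall V, translation r V -> zone r (answer r V) &
      (forall f, zone r f -> forall x, `|f x| < 2 * n.+1%:R^-1) \/
      (forall V, translation r V ->
         forall x, V x -> `|answer r V x| < 2 * n.+1%:R^-1)].
apply: (@strategies_carry_G s _ _ (Cp0 R X) _ _ _ _ good).
- move=> n D MD.
  have [[f [Df f0 fn]]|[U [g [UG gP]]]] := approximating_dichotomy n Mapp MD.
    exists (Reduction U0 (fun=> f) [set f]); split=> //=.
    + by move=> _ ->.
    + by exists f.
    + by left=> _ ->.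
  exists (Reduction U g (D `\ Cp0 R X)); split=> //=.
  + have [[_ /infinite_setN0[V /gP[DV V0 _]] _] _ _] := UG.
    by exists (g V); split.
  + by move=> V /gP[DV V0 _]; split.
  + by right=> V /gP[].
- by move=> n D r MD [rG rD r0 rA _]; split=> // f /rD[].
- move=> D r b b' MD rP bP [[[_ _] bomega] _] b'P gb; apply: Omega_at_Cp0.
    move=> [n _ b0]; have [_ zD _ _ _] := rP n.
    by have [_] := zD _ ((b'P n).1 _ b0); apply.
  move=> K e Kfin /natSinv_lt[N NP].
  have [[n [Nn rn]]|noround] := pselect (exists n, (N <= n)%N /\
      forall f, zone (r n) f -> forall x, `|f x| < 2 * n.+1%:R^-1).
    have [b'n [f bf]] := b'P n; exists f; first by exists n.
    by move=> x _; apply: lt_trans (NP n Nn); apply: rn; exact: b'n.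
  (* Only finitely many rounds remain below [N]. Enlarging [K] by a point outside
     each set selected there forces the set containing [K] to be selected in a
     later round. *)
  pose early := \bigcup_(n in `I_N) b n.
  have earlyfin : finite_set early.
    by apply: bigcup_finite => [|n _]; [exact: finite_II | exact: (bP n).1].
  have /choice[pt ptP] : forall V, exists S : set X, finite_set S /\
      (early V -> ~ S `<=` V).
    move=> V; have [[n _ bV]|] := pselect (early V); last by exists set0.
    have [[[[_ rT] _ _] _ _] _ _ _ _] := rP n.
    have /eqP/setTPn[x nVx] : V <> setT.
      by move=> VT; apply: rT; rewrite -VT; exact: (bP n).2.
    by exists [set x]; split=> // _ /(_ x erefl).
  have [|V [n _ bV] KV] := bomega (K `|` \bigcup_(V in early) pt V).
    by rewrite finite_setU; split=> //; apply: bigcup_finite => // V _;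
      exact: (ptP V).1.
  have Nn : (N <= n)%N.
    rewrite leqNgt; apply/negP => nN.
    have earlyV : early V by exists n.
    by apply: ((ptP V).2 earlyV) => x Vx; apply: KV; right; exists V.
  exists (answer (r n) V); first by exists n => //; apply: gb; exists V.
  have [_ _ _ _ [rn|rn]] := rP n; first by case: noround; exists n.
  move=> x Kx; apply: lt_trans (NP n Nn); apply: rn; first exact: (bP n).2.
  by apply: KV; left.
Qed.

(** * The two classes of moves *)

Lemma Gamma_at_approximating : approximating (Gamma_at_moves (Cp0 R X)).
Proof.
move=> n A [[AE|[/infinite_set_seq[u u_inj Au] A0 Alim]] nAE].
  by case: nAE.
exists 0, u; split=> [|//|k uk|].
- by rewrite normr0 invr_ge0.
- by apply: A0; rewrite -uk.
apply/(Cp_cvg_seqP u (Cp0 R X)) => W /Alim /(near_infty_inj_notin u_inj).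
by apply: filterS => k nAW; apply: contrapT => nW; apply: nAW; split.
Qed.

(** A sequence converging to the nonzero constant [n.+1%:R^-1] is eventually
    nonzero at the point [x0], hence avoids the zero function once an initial
    segment is dropped. *)
Lemma sequentially_dense_approximating :
  X -> approximating (sequentially_dense (Cp R X)).
Proof.
move=> x0 n D Ddense; pose c : R := n.+1%:R^-1.
have c0 : 0 < c by rewrite invr_gt0.
have [u Du uc] := Ddense (mkcts (fun x : X => @cst_continuous X R c x)).
have {}uc x : u k x @[k --> \oo] --> c by exact: (Cp_cvg_seqP u _).1 uc x.
have /cvgrPdist_lt/(_ c c0)[N _ NP] := uc x0.
exists c, (fun k => u (k + N)%N); split=> [|//|k uk|x].
- by rewrite gtr0_norm.
- by have := NP (k + N)%N (leq_addl _ _); rewrite /= uk /= subr0 gtr0_norm// ltxx.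
- by rewrite (cvg_shiftn N (fun k => u k x)); exact: uc.
Qed.

End Games.

Theorem theorem4p8 (R : realType) (X : topologicalType) (s : selection)
    (X_infinite : infinite_set [set: X]) (X_tychonoff : tychonoff_space X) :
  [<-> two_has_winning_strategy (G s (GammaF R X) (open_omega_covers X));
       two_has_winning_strategy
         (G s (Gamma_at_moves (Cp0 R X)) (Omega_at (Cp0 R X)));
       two_has_winning_strategy
         (G s (sequentially_dense (Cp R X)) (Omega_at (Cp0 R X)))]
  /\
  [<-> two_has_winning_markov_strategy (G s (GammaF R X) (open_omega_covers X));
       two_has_winning_markov_strategy
         (G s (Gamma_at_moves (Cp0 R X)) (Omega_at (Cp0 R X)));
       two_has_winning_markov_strategy
         (G s (sequentially_dense (Cp R X)) (Omega_at (Cp0 R X)))].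
Proof.
have [x _] := infinite_setN0 X_infinite.
have [to_Gamma to_Gamma_markov] :=
  strategies_carry_from_covers s (@Gamma_at_approximating R X).
have [to_dense to_dense_markov] :=
  strategies_carry_from_covers s (@sequentially_dense_approximating R X x).
have [of_Gamma of_Gamma_markov] :=
  strategies_carry_to_covers s (@confined_Gamma_at R X).
have [of_dense of_dense_markov] : strategies_carry
    (G s (sequentially_dense (Cp R X)) (Omega_at (Cp0 R X)))
    (G s (GammaF R X) (open_omega_covers X)).
  apply: strategies_carry_to_covers => U UG.
  by exists (confined U) => //; exact: confined_sequentially_dense.
split; tfae.
- exact: to_Gamma.
- by move=> /of_Gamma/to_dense.
- exact: of_dense.
- exact: to_Gamma_markov.
- by move=> /of_Gamma_markov/to_dense_markov.
- exact: of_dense_markov.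
Qed.
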